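(* For any $n\in\mathbb{N}$, any $n$-vertex simple graph $G$ with vertex set $V$, and any nonnegative integer $t$, \[ i_t(G)=\sum_{j=0}^{t}\binom{n-j}{t-j}N_j(G), \] where $N_0(G):=1$ and, for $j\geq 1$, $N_j(G):=\sum_{J\in V^{(j)}}\psi(J)$.
   Context: All graphs are finite and simple. $i_t(G)$ denotes the number of independent sets of $G$ of size exactly $t$. For a set $A$ and integer $j\ge 0$, $A^{(j)}$ denotes the set of all $j$-element subsets of $A$. For $J\subseteq V(G)$, $G[J]$ is the subgraph of $G$ induced by $J$. A set of edges $S\subseteq E(G[J])$ is an edge-covering of $G[J]$ if every vertex of $J$ is incident to at least one edge of $S$. For $J\subseteq V(G)$, $\psi_e(J)$ is the number of edge-coverings of $G[J]$ with an even number of edges, $\psi_o(J)$ is the number of edge-coverings of $G[J]$ with an odd number of edges, and $\psi(J):=\psi_e(J)-\psi_o(J)\in\mathbb{Z}$. *)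

(* Defs.v *)
From mathcomp Require Import all_boot all_order all_algebra.

Set Implicit Arguments.
Unset Strict Implicit.
Unset Printing Implicit Defensive.

Import GRing.Theory.
Local Open Scope ring_scope.

Record sgraph := SGraph {
  vertex :> finType;
  adj : rel vertex;
  adj_sym : symmetric adj;
  adj_irrefl : irreflexive adj }.

Section Graph.
Variable G : sgraph.
Implicit Types (I J : {set G}) (S : {set {set G}}).

Definition edges : {set {set G}} :=
  [set [set x; y] | x in G, y in G & adj x y].

Definition independent I : bool :=
  [forall x in I, forall y in I, ~~ adj x y].

Definition nb_independent (t : nat) : nat :=
  #|[set I : {set G} | independent I & #|I| == t]|.

(* The edge set of G[J]; its vertex set is J itself, so that edge-coverings
   of G[J] can be expressed without passing to a subtype. *)
Definition induced_edges J : {set {set G}} :=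
  [set f in edges | f \subset J].

Definition edge_covering J S : bool :=
  (S \subset induced_edges J) && [forall x in J, exists f in S, x \in f].

Definition psi_e J : nat :=
  #|[set S : {set {set G}} | edge_covering J S & ~~ odd #|S|]|.

Definition psi_o J : nat :=
  #|[set S : {set {set G}} | edge_covering J S & odd #|S|]|.

Definition psi J : int := (psi_e J)%:Z - (psi_o J)%:Z.

Definition Ncov (j : nat) : int :=
  if j == 0%N then 1 else \sum_(J : {set G} | #|J| == j) psi J.

End Graph.

(* Main.v *)
Require Import Defs.
From mathcomp Require Import all_boot all_order all_algebra.
Import GRing.Theory.
Local Open Scope ring_scope.

(** The identity is inclusion-exclusion over edges, followed by a regrouping.
    A vertex set [I] is independent exactly when [G[I]] has no edge, so its
    indicator is the alternating sum of [(-1) ^+ #|S|] over all sets [S] of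
    edges of [G[I]] ([sum_sign_subset], [independentE]). Each such [S] is an
    edge-covering of exactly one [J], namely the set [cover S] of the vertices
    it touches ([edge_coveringE]), and the condition that [S] lies in [G[I]]
    becomes [J \subset I]. Hence the indicator of [I] is the sum of [psi J]
    over [J \subset I] ([independent_sum_psi]). Summing over the [I] of size
    [t] and exchanging the two sums, each [J] of size [j <= t] is counted once
    for every [t]-set above it, that is ['C(n - j, t - j)] times
    ([card_supersets]). The convention for [j = 0] fits in because the empty
    set has the empty edge-covering only, so that [psi set0 = 1]. *)

Lemma card_sum_ones (T : finType) (P : pred T) :
  #|[set x | P x]|%:Z = \sum_(x | P x) 1.
Proof. by rewrite -natz -sum1dep_card natr_sum. Qed.

(** Expanding the product of [1 - [i \in A]] over all [i] gives the sum on the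
    left, while the product vanishes as soon as [A] has an element. *)
Lemma sum_sign_subset (R : comNzRingType) (T : finType) (A : {set T}) :
  \sum_(S : {set T} | S \subset A) (-1) ^+ #|S| = (A == set0)%:R :> R.
Proof.
have /esym := @bigA_distr R 0 1 *%R +%R T (fun i => - (i \in A)%:R) (fun=> 1).
rewrite [LHS](bigID (fun S : {set T} => S \subset A)) /=.
rewrite [X in _ + X]big1 ?addr0 => [|S /subsetPn[x xS xA]]; last first.
  by rewrite (bigD1 x) //= xS (negbTE xA) oppr0 mul0r.
have -> : \sum_(S : {set T} | S \subset A)
      \prod_i (if i \in S then - (i \in A)%:R else 1)
    = \sum_(S : {set T} | S \subset A) (-1) ^+ #|S| :> R.
  apply: eq_bigr => S /subsetP sSA; rewrite -big_mkcond /= -prodr_const.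
  by apply: eq_bigr => i /sSA ->.
move=> ->; case: (set_0Vmem A) => [->|[x xA]].
  by rewrite eqxx big1 // => i _; rewrite inE oppr0 add0r.
rewrite (bigD1 x) //= xA addNr mul0r.
by case: eqP => // A0; rewrite A0 inE in xA.
Qed.

(** Adding [J] is a bijection from the subsets of [~: J] of size [t - #|J|]
    onto the sets counted here. *)
Lemma card_supersets (T : finType) (J : {set T}) (t : nat) : (#|J| <= t)%N ->
  #|[set I : {set T} | J \subset I & #|I| == t]| = 'C(#|T| - #|J|, t - #|J|).
Proof.
move=> leJt.
have -> : (#|T| - #|J|)%N = #|~: J| by rewrite [RHS]cardsCs setCK.
rewrite -cards_draws.
have disjJ (K : {set T}) : K \subset ~: J -> J :&: K = set0.
  by move=> sK; apply/eqP; rewrite setI_eq0 disjoint_sym disjoints_subset.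
rewrite -[RHS](@card_in_imset _ _ (setU J)) => [|K L]; last first.
  rewrite !inE => /andP[sK _] /andP[sL _] /(congr1 (fun X => X :\: J)).
  by rewrite !setDUl !setDv !set0U !setDE (setIidPl sK) (setIidPl sL).
apply: eq_card => I; rewrite inE.
apply/andP/imsetP => [[sJI /eqP cI]|[K]].
  exists (I :\: J); last by rewrite setDE setUIr setUCr setIT (setUidPr sJI).
  by rewrite inE setDE subsetIr -setDE cardsD (setIidPr sJI) cI eqxx.
rewrite inE => /andP[sK /eqP cK] ->; split; first exact: subsetUl.
by rewrite cardsU (disjJ _ sK) cards0 subn0 cK subnKC.
Qed.

Section IndependentSets.
Variable G : sgraph.
Implicit Types (I J : {set G}) (S : {set {set G}}).

Lemma edges_neq0 (f : {set G}) : f \in edges G -> f != set0.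
Proof.
by case/imset2P => x y _ _ ->; apply/set0Pn; exists x; rewrite !inE eqxx.
Qed.

Lemma independentE I : independent I = (induced_edges I == set0).
Proof.
apply/idP/eqP => [/forall_inP indI | E0].
  apply/setP => f; rewrite !inE; apply/negP => /andP[].
  case/imset2P => x y _ /[!inE] /andP[_ xy] -> /subsetP sI.
  have /forall_inP indx : [forall z in I, ~~ adj x z].
    by apply/indI/sI; rewrite !inE eqxx.
  by case/negP: (indx y (sI y (set22 x y))).
apply/forall_inP => x xI; apply/forall_inP => y yI; apply/negP => xy.
have : [set x; y] \in induced_edges I.
  rewrite inE subUset !sub1set xI yI !andbT.
  by apply/imset2P; exists x y; rewrite ?inE.
by rewrite E0 inE.
Qed.

Lemma sub_induced_edges I S :
  (S \subset induced_edges I) = (S \subset edges G) && (cover S \subset I).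
Proof.
rewrite /induced_edges setIdE subsetI; congr (_ && _).
apply/subsetP/bigcupsP => H f /H; rewrite ?inE //.
Qed.

(** An edge-covering of [G[J]] determines [J]; this is what allows the edge
    sets to be classified by the vertex set that they cover. *)
Lemma edge_coveringE J S :
  edge_covering J S = (S \subset edges G) && (cover S == J).
Proof.
rewrite /edge_covering sub_induced_edges -andbA eqEsubset; congr (_ && (_ && _)).
apply/forall_inP/subsetP => H x /H.
  by case/exists_inP => f fS xf; apply/bigcupP; exists f.
by case/bigcupP => f fS xf; apply/exists_inP; exists f.
Qed.

Lemma psi_sum_sign J : psi J = \sum_(S | edge_covering J S) (-1) ^+ #|S|.
Proof.
rewrite (bigID (fun S => odd #|S|)) /= addrC /psi /psi_e /psi_o.
rewrite !card_sum_ones -sumrN; congr (_ + _); apply: eq_bigr => S /andP[_].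
  by rewrite -signr_odd => /negbTE ->.
by rewrite -signr_odd => ->.
Qed.

Lemma psi0 : psi (set0 : {set G}) = 1.
Proof.
rewrite psi_sum_sign (big_pred1 set0) ?cards0 // => S.
rewrite edge_coveringE /=; apply/andP/eqP => [[/subsetP sE /eqP S0]|->].
  apply/eqP/set0Pn => -[f fS]; case/negP: (edges_neq0 _ (sE f fS)).
  by rewrite -subset0 -S0 (bigcup_max f).
by rewrite sub0set /cover big_set0.
Qed.

(** Makes the case [j = 0], set apart in [Ncov], an instance of the general
    formula. *)
Lemma Ncov_sum_psi j : Ncov G j = \sum_(J : {set G} | #|J| == j) psi J.
Proof.
rewrite /Ncov; case: eqP => // ->.
by rewrite (big_pred1 set0) ?psi0 // => J; rewrite cards_eq0.
Qed.

(** Inclusion-exclusion on the edges of [G[I]], with the edge sets grouped by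
    the vertex set that they cover. *)
Lemma independent_sum_psi I :
  (independent I)%:R = \sum_(J : {set G} | J \subset I) psi J.
Proof.
rewrite independentE -(sum_sign_subset int).
rewrite (partition_big (@cover _) (fun J => J \subset I)) /= => [|S]; last first.
  by rewrite sub_induced_edges => /andP[].
apply: eq_bigr => J sJI; rewrite psi_sum_sign; apply: eq_bigl => S.
rewrite sub_induced_edges edge_coveringE -andbA.
by case: eqP => [->|]; rewrite ?sJI ?andbF.
Qed.

End IndependentSets.

(* For j > n the truncated subtraction n - j is harmless: Ncov G j is then an
   empty sum. *)
Theorem theorem2p1 (n : nat) (G : sgraph) (hn : #|G| = n) (t : nat) :
  (nb_independent G t)%:Z =
  \sum_(0 <= j < t.+1) ('C(n - j, t - j))%:Z * Ncov G j.
Proof.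
have -> : (nb_independent G t)%:Z
    = \sum_(I : {set G} | #|I| == t) (independent I)%:R :> int.
  rewrite /nb_independent card_sum_ones big_mkcondl.
  by apply: eq_bigr => I _; case: independent.
under eq_bigr do rewrite independent_sum_psi.
rewrite (exchange_big_dep (fun J : {set G} => (#|J| < t.+1)%N)) /=; last first.
  by move=> I J /eqP <- /subset_leq_card.
rewrite big_mkord.
(* After the exchange [#|J| <= t], so [inord] loses nothing and the outer sum
   splits according to the size of [J]. *)
rewrite (partition_big (fun J : {set G} => inord #|J| : 'I_t.+1) predT) //=.
apply: eq_bigr => j _; rewrite Ncov_sum_psi mulr_sumr.
apply: eq_big => [J|J /andP[leJt /eqP <-]].
  case: ltnP => [leJt|ltJ] /=; first by rewrite -val_eqE /= inordK.
  by apply/esym/eqP => Jj; move: ltJ; rewrite Jj leqNgt ltn_ord.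
rewrite inordK // -hn -card_supersets // card_sum_ones mulr_suml.
by apply: eq_big => [I|I _]; rewrite ?mul1r // andbC.
Qed.
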